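(* Let $n,p\in\mathbb{N}$ and $\epsilon>0$. For every $\epsilon$-differentially private algorithm which takes data sets of size $n$ with entries in $\{-\frac{1}{\sqrt p},\frac{1}{\sqrt p}\}^p$ and whose output, denoted $\theta^{priv}$, lies in the Euclidean unit ball $\mathbb{B}\subset\mathbb{R}^p$, there is a data set $\mathcal{D}=\{d_1,\dots,d_n\}\subseteq\{-\frac{1}{\sqrt p},\frac{1}{\sqrt p}\}^p$ such that, with probability at least $1/2$ over the algorithm's random coins, $$\mathcal{L}(\theta^{priv};\mathcal{D})-\mathcal{L}(\theta^*;\mathcal{D})=\Omega\left(\min\left(n,\frac{p^2}{\epsilon^2n}\right)\right),$$ where $\mathcal{L}(\theta;\mathcal{D})=\frac12\sum_{i=1}^n\|\theta-d_i\|_2^2$ for $\theta\in\mathbb{B}$, and $\theta^*=\frac1n\sum_{i=1}^nd_i$ is the minimizer of $\mathcal{L}(\cdot;\mathcal{D})$ over $\mathbb{B}$.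
   Context: $\Omega(\cdot)$ hides an absolute positive multiplicative constant. Data sets are multisets (entries may repeat). Differential privacy: two data sets of size $n$ are neighbors if they differ in one entry. A randomized algorithm $\mathcal{A}$ is $\epsilon$-differentially private if for all neighboring $\mathcal{D},\mathcal{D}'$ and all events $S$ in the output space, $\Pr(\mathcal{A}(\mathcal{D})\in S)\le e^{\epsilon}\Pr(\mathcal{A}(\mathcal{D}')\in S)$.
   Formalization: The claim is proved for n, p ≥ 1 with np > 1 and ε ≤ p/2; for n = p = 1, or for ε large compared with p (e.g. n = 1 and e^ε > 2^p − 1), it is false, since randomized response returns θ* exactly with probability above 1/2. *)

(* Defs.v *)
From HB Require Import structures.
From mathcomp Require Import all_boot all_order all_algebra.
From mathcomp Require Import all_classical all_reals all_analysis.
From mathcomp Require Import ring lra.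
Set Implicit Arguments.
Unset Strict Implicit.
Unset Printing Implicit Defensive.
Import Order.TTheory GRing.Theory Num.Theory.
Import numFieldNormedType.Exports.
Local Open Scope classical_set_scope.
Local Open Scope ring_scope.

(* The library norm on ['rV[R]_p] is the sup norm, hence this definition. *)
Definition norm2 (R : realType) (p : nat) (v : 'rV[R]_p) : R :=
  Num.sqrt (\sum_(j < p) v 0 j ^+ 2).

Definition unit_ball (R : realType) (p : nat) : set 'rV[R]_p :=
  [set v | norm2 v <= 1].

Definition in_cube (R : realType) (p : nat) (d : 'rV[R]_p) : bool :=
  [forall j, (d 0 j == - (1 / Num.sqrt p%:R)) || (d 0 j == 1 / Num.sqrt p%:R)].

Definition entry (R : realType) (p : nat) := {d : 'rV[R]_p | in_cube d}.

(* A data set is a multiset of size n; it is represented by an enumeration of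
   its entries, and algorithms are required to be [multiset_invariant]. *)
Definition data_set (R : realType) (n p : nat) := n.-tuple (entry R p).

Definition neighbors (R : realType) (n p : nat) (D D' : data_set R n p) : Prop :=
  #|[set i | tnth D i != tnth D' i]%SET| = 1%N.

(* R^p with its Borel sigma-algebra. *)
Definition borel (R : realType) (p : nat) :=
  g_sigma_algebraType (@open 'rV[R]_p).

(* [A D] is the law, over the random coins, of the output on the data set D. *)
Definition algorithm (R : realType) (n p : nat) :=
  data_set R n p -> probability (borel R p) R.

Definition multiset_invariant (R : realType) (n p : nat)
    (A : algorithm R n p) : Prop :=
  forall D D' : data_set R n p, perm_eq D D' -> A D = A D'.

Definition output_in_ball (R : realType) (n p : nat)
    (A : algorithm R n p) : Prop :=
  forall D, A D (@unit_ball R p) = 1%E.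

Definition differentially_private (R : realType) (n p : nat) (eps : R)
    (A : algorithm R n p) : Prop :=
  forall D D' : data_set R n p, neighbors D D' ->
  forall S : set (borel R p), measurable S ->
    (A D S <= (expR eps)%:E * A D' S)%E.

Definition loss (R : realType) (n p : nat) (D : data_set R n p)
    (theta : 'rV[R]_p) : R :=
  1 / 2 * \sum_(i < n) norm2 (theta - val (tnth D i)) ^+ 2.

Definition theta_star (R : realType) (n p : nat) (D : data_set R n p) :
    'rV[R]_p :=
  n%:R^-1 *: \sum_(i < n) val (tnth D i).

Definition excess_loss (R : realType) (n p : nat) (D : data_set R n p)
    (theta : 'rV[R]_p) : R :=
  loss D theta - loss D (theta_star D).

Lemma norm2_sq (R : realType) (p : nat) (v : 'rV[R]_p) :
  norm2 v ^+ 2 = \sum_(j < p) v 0 j ^+ 2.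
Proof. by rewrite sqr_sqrtr // sumr_ge0 // => j _; rewrite sqr_ge0. Qed.

Lemma excess_lossE (R : realType) (n p : nat) (D : data_set R n p)
    (theta : 'rV[R]_p) : (0 < n)%N ->
  excess_loss D theta = n%:R / 2 * norm2 (theta - theta_star D) ^+ 2.
Proof.
move=> n0; have nz : n%:R != 0 :> R by rewrite pnatr_eq0 -lt0n.
rewrite /excess_loss /loss -mulrBr -sumrB norm2_sq.
under eq_bigr do rewrite !norm2_sq -sumrB.
have subE (u v : 'rV[R]_p) j : (u - v) 0 j = u 0 j - v 0 j.
  by rewrite mxE [X in _ + X]mxE.
rewrite exchange_big /= !mulr_sumr; apply: eq_bigr => j _.
set t := theta 0 j; set m := theta_star D 0 j.
have mE : \sum_(i < n) val (tnth D i) 0 j = n%:R * m.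
  by rewrite /m /theta_star mxE summxE mulrA mulfV // mul1r.
rewrite (eq_bigr (fun i => (t ^+ 2 - m ^+ 2)
  - 2 * (t - m) * val (tnth D i) 0 j)); last first.
  by move=> i _; rewrite !subE -/t -/m; ring.
rewrite sumrB sumr_const card_ord -mulr_sumr mE -mulr_natl subE -/t -/m.
by field.
Qed.

Lemma theta_star_in_ball (R : realType) (n p : nat) (D : data_set R n p) :
  (0 < n)%N -> (0 < p)%N -> unit_ball (theta_star D).
Proof.
move=> n0 p0; have sp : 0 < Num.sqrt p%:R :> R by rewrite sqrtr_gt0 ltr0n.
rewrite /unit_ball /= -(@ler_pXn2r _ 2) ?nnegrE ?sqrtr_ge0 // norm2_sq expr1n.
have ->: 1 = \sum_(j < p) (1 / Num.sqrt p%:R) ^+ 2 :> R.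
  rewrite sumr_const card_ord expr_div_n expr1n sqr_sqrtr ?ler0n //.
  by rewrite -[RHS]mulr_natl mul1r mulfV // pnatr_eq0 -lt0n.
apply: ler_sum => j _; rewrite -real_normK ?num_real //.
rewrite ler_pXn2r ?nnegrE ?normr_ge0 ?divr_ge0 ?(ltW sp) //.
rewrite mxE normrM normfV normr_nat ler_pdivrMl ?ltr0n //.
rewrite summxE; apply: (le_trans (ler_norm_sum _ _ _)).
rewrite mulr_natl -[X in _ *+ X](card_ord n) -sumr_const.
apply: ler_sum => i _; have /forallP/(_ j) := valP (tnth D i).
have q0 : 0 <= 1 / Num.sqrt p%:R :> R by rewrite divr_ge0 // ltW.
by case/orP => /eqP ->; rewrite ?normrN ger0_norm.
Qed.

Lemma theta_star_min (R : realType) (n p : nat) (D : data_set R n p)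
    (theta : 'rV[R]_p) : (0 < n)%N -> loss D (theta_star D) <= loss D theta.
Proof.
move=> n0; rewrite -subr_ge0 -/(excess_loss D theta) excess_lossE //.
by rewrite mulr_ge0 ?sqr_ge0 // divr_ge0 ?ler0n.
Qed.

(* Main.v *)
(* Packing. The excess loss is [n/2 * |theta - theta_star|^2]. For [p >= 2],
   replacing the first [m = min(n, floor(p / (2 eps)))] entries of a constant
   data set by a cube point [v] gives [2^p] data sets, each within [m]
   replacements of the base one, whose minimizers are at squared distance
   [4 (m/n)^2 ham(v, w) / p]. If on each data set the output were close to the
   minimizer with probability more than 1/2, group privacy would give each of
   these events probability more than [e^(- eps m) / 2 >= e^(- p/2) / 2] under
   the base data set. But an output is close to at most [N] of the minimizers,
   [N] being the size of a Hamming ball of radius [p/32], so these probabilities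
   sum to at most [N]; this fails because [(2 N - 1) e^(p/2) <= 2^p - 1].
   For [p = 1] the two cube points are too few, and three thresholds
   [0, m, 2m] for the number of positive entries are used: the middle data set
   is the base, and [2 < e^(1/2)] fails. *)
Require Import Defs.
From mathcomp Require Import all_boot all_order all_algebra.
From mathcomp Require Import all_classical all_reals all_analysis.
From mathcomp Require Import measurable_realfun ring lra zify.
Set Implicit Arguments.
Unset Strict Implicit.
Unset Printing Implicit Defensive.
Import Order.TTheory GRing.Theory Num.Theory.
Import numFieldNormedType.Exports.
Local Open Scope classical_set_scope.
Local Open Scope ring_scope.

(** * Group privacy and the packing inequality *)

(** Induction on the number of differing positions: [D1] copies one of them from [D'], so it is a
    neighbor of [D] with one difference fewer. *)
Lemma group_privacy (R : realType) (n p : nat) (eps : R) (A : algorithm R n p)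
    (k : nat) (D D' : data_set R n p) (S : set (borel R p)) :
  differentially_private eps A -> measurable S ->
  #|[set i | tnth D i != tnth D' i]%SET| = k ->
  (A D S <= (expR (eps * k%:R))%:E * A D' S)%E.
Proof.
move=> dp mS; elim: k D => [|k IHk] D dk.
  suff -> : D = D' by rewrite mulr0 expR0 mul1e.
  apply: eq_from_tnth => i; apply/eqP; apply: contraT => ne.
  by have := cards0_eq dk => /setP/(_ i); rewrite !inE ne.
have /card_gt0P[i0] : (0 < #|[set i | tnth D i != tnth D' i]%SET|)%N by rewrite dk.
rewrite inE => i0P.
pose D1 : data_set R n p :=
  [tuple if i == i0 then tnth D' i else tnth D i | i < n].
have nb : neighbors D D1.
  rewrite /neighbors (_ : [set i | _]%SET = [set i0]%SET) ?cards1 //.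
  apply/setP => i; rewrite !inE tnth_mktuple.
  by have [->|_] := eqVneq i i0; rewrite ?i0P ?eqxx.
have d1k : #|[set i | tnth D1 i != tnth D' i]%SET| = k.
  apply/eqP; rewrite -eqSS -dk (cardsD1 i0 [set i | tnth D i != _]%SET) inE i0P.
  apply/eqP; rewrite add1n; congr _.+1; apply: eq_card => i.
  rewrite !inE tnth_mktuple.
  by have [->|_] := eqVneq i i0; rewrite ?eqxx.
apply: (le_trans (dp _ _ nb _ mS)).
have -> : eps * k.+1%:R = eps + eps * k%:R by rewrite -natr1 mulrDr mulr1 addrC.
rewrite expRD EFinM -muleA.
by apply: lee_wpmul2l; [rewrite lee_fin expR_ge0|exact: IHk].
Qed.

(** Integrating the number of events that contain a point against [mu i0] gives at most [N]. In this
    sum the term [i0] exceeds 1/2, and each other term is at least [1 / (2 * expR x)]. *)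
Lemma packing_bound (d : measure_display) (T : measurableType d) (R : realType)
    (I : finType) (mu : I -> probability T R) (B : I -> set T) (i0 : I) (x N : R) :
  (forall i, measurable (B i)) ->
  (forall i, ((1 / 2)%:E < mu i (B i))%E) ->
  (forall i, (mu i (B i) <= (expR x)%:E * mu i0 (B i))%E) ->
  (forall t, #|[set i | t \in B i]%SET|%:R <= N) ->
  #|I|%:R - 1 < (2 * N - 1) * expR x.
Proof.
move=> mB hB hx hN.
have sumB : (\sum_(i : I) mu i0 (B i) <= N%:E)%E.
  have -> : (\sum_(i : I) mu i0 (B i) =
             \int[mu i0]_t (\sum_(i : I) (\1_(B i) t)%:E))%E.
    rewrite ge0_integral_sum //; last first.
      by move=> i; apply/measurable_EFinP; exact: measurable_indic.
    by apply: eq_bigr => i _; rewrite integral_indic // setIT.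
  have -> : N%:E = (\int[mu i0]_t (cst N%:E) t)%E.
    by rewrite integral_cst // [X in (_ * X)%E]probability_setT mule1.
  apply: ge0_le_integral => //.
  - by move=> t _; apply: sume_ge0 => i _; rewrite lee_fin.
  - apply: emeasurable_sum => i; apply/measurable_EFinP.
    exact: measurable_indic.
  move=> t _; rewrite sumEFin lee_fin /cst.
  apply: le_trans (hN t); rewrite -sum1dep_card natr_sum /=.
  rewrite [leRHS]big_mkcond /=; apply: ler_sum => i _.
  by rewrite indicE; case: (t \in B i).
pose b i := fine (mu i0 (B i)).
have bE i : mu i0 (B i) = (b i)%:E by rewrite fineK // fin_num_measure.
move: sumB; under eq_bigr do rewrite bE.
rewrite sumEFin lee_fin (bigD1 i0) //= => sumb.
have b0 : 1 / 2 < b i0 by rewrite -lte_fin -bE.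
have ex := expR_gt0 x.
have bi i : 1 / (2 * expR x) <= b i.
  rewrite ler_pdivrMr ?mulr_gt0 //.
  have := lt_le_trans (hB i) (hx i); rewrite bE -EFinM lte_fin; lra.
have : \sum_(i | i != i0) 1 / (2 * expR x) <= \sum_(i | i != i0) b i.
  by apply: ler_sum.
rewrite sumr_const cardC1 => bs.
have cI : #|I|%:R = #|I|.-1%:R + 1 :> R.
  by rewrite natr1 prednK //; apply/card_gt0P; exists i0.
rewrite cI addrK.
have : (1 / (2 * expR x)) *+ #|I|.-1 < N - 1 / 2 by lra.
rewrite -mulr_natr mulrAC ltr_pdivrMr ?mulr_gt0 //; lra.
Qed.

(** * Separated minimizers under a private algorithm *)

Lemma continuous_sumr (T : topologicalType) (R : realType) (I : Type)
    (r : seq I) (f : I -> T -> R) :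
  (forall i, continuous (f i)) -> continuous (fun x => \sum_(i <- r) f i x).
Proof.
move=> cf; elim: r => [|i r IHr].
  by under eq_fun do rewrite big_nil; move=> x; exact: cvg_cst.
under eq_fun do rewrite big_cons.
by move=> x; apply: cvgD; [exact: cf|exact: IHr].
Qed.

Lemma row_subE (R : realType) (p : nat) (u v : 'rV[R]_p) (j : 'I_p) :
  (u - v) 0 j = u 0 j - v 0 j.
Proof. by rewrite mxE [X in _ + X]mxE. Qed.

(** A strict sublevel set of a polynomial in the coordinates is open. *)
Lemma measurable_excess_lt (R : realType) (n p : nat) (D : data_set R n p)
    (t : R) : (0 < n)%N ->
  measurable ([set theta | excess_loss D theta < t] : set (borel R p)).
Proof.
move=> n0; apply: sub_sigma_algebra.
have -> : [set theta | excess_loss D theta < t] =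
  (fun theta : 'rV[R]_p => \sum_(j < p) (n%:R / 2 * (theta 0 j - theta_star D 0 j) ^+ 2))
    @^-1` [set y | y < t].
  apply/funext => theta /=; rewrite excess_lossE // norm2_sq mulr_sumr.
  by congr (_ < _); apply: eq_bigr => j _; rewrite row_subE.
apply: open_comp => [theta _|]; last exact: open_lt.
apply: (@continuous_sumr _ _ _ _ (fun j (v : 'rV[R]_p) =>
  n%:R / 2 * (v 0 j - theta_star D 0 j) ^+ 2)) => j {}theta.
have cj : {for theta, continuous (fun v : 'rV[R]_p => v 0 j - theta_star D 0 j)}.
  exact: (cvgB (@coord_continuous R 1 p 0 j theta) (cvg_cst _)).
exact: (cvgM (cvg_cst _) (cvgM cj cj)).
Qed.

(** By the parallelogram identity, the gap in each coordinate is [(2 w - u - v)^2]. *)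
Lemma norm2_sub_sq_le (R : realType) (p : nat) (u v w : 'rV[R]_p) :
  norm2 (u - v) ^+ 2 <= 2 * norm2 (w - u) ^+ 2 + 2 * norm2 (w - v) ^+ 2.
Proof.
rewrite !norm2_sq !mulr_sumr -big_split /=; apply: ler_sum => j _.
rewrite !row_subE; have := sqr_ge0 (2 * w 0 j - u 0 j - v 0 j); nra.
Qed.

(** Excess below [t] means squared distance below [2 t / n] to the minimizer. Two minimizers that
    share such an output are therefore at squared distance below [8 t / n <= s], and [packing_bound]
    applies with this [N]. The last hypothesis is the negation of the lower bound, so the conclusion
    is there to be refuted. *)
Lemma private_family_card (R : realType) (n p : nat) (eps s t : R)
    (A : algorithm R n p) (I : finType) (D : I -> data_set R n p) (i0 : I)
    (m : nat) (N : R) :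
  (0 < n)%N -> 0 <= eps -> 8 * t <= n%:R * s ->
  differentially_private eps A ->
  (forall i, (#|[set k | tnth (D i) k != tnth (D i0) k]%SET| <= m)%N) ->
  (forall i, #|[set k |
     norm2 (theta_star (D i) - theta_star (D k)) ^+ 2 < s]%SET|%:R <= N) ->
  (forall i, (A (D i) [set theta | (t <= excess_loss (D i) theta)%R]
                < (1 / 2)%:E)%E) ->
  #|I|%:R - 1 < (2 * N - 1) * expR (eps * m%:R).
Proof.
move=> n0 eps0 ts dp hm hN hA.
pose B i : set (borel R p) := [set theta | excess_loss (D i) theta < t].
have mB i : measurable (B i) by exact: measurable_excess_lt.
apply: (@packing_bound _ _ _ _ (fun i => A (D i)) B i0) => //.
- move=> i; have BC : B i = ~` [set theta | t <= excess_loss (D i) theta].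
    by apply/seteqP; split=> theta; rewrite /B /= ltNge => /negP.
  have mG : measurable ([set theta | t <= excess_loss (D i) theta] : set (borel R p)).
    by rewrite -[X in measurable X]setCK -BC; exact: measurableC.
  rewrite BC probability_setC //.
  have := hA i; set q := A _ _.
  have -> : q = (fine q)%:E by rewrite fineK // fin_num_measure.
  rewrite -EFinB !lte_fin; lra.
- move=> i; apply: (le_trans (group_privacy dp (mB i) erefl)).
  apply: lee_wpmul2r => //; rewrite lee_fin ler_expR ler_wpM2l //.
  by rewrite ler_nat.
(* If some event [k] contains [theta], all the others that do have minimizers close to that of [k];
   if none does, only [0 <= N] is left to show. *)
move=> theta; have [->|[k]] := set_0Vmem [set i | theta \in B i]%SET.
  by rewrite cards0; apply: le_trans (hN i0); rewrite ler0n.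
rewrite inE => /set_mem kB; apply: le_trans (hN k); rewrite ler_nat.
apply: subset_leq_card; apply/fintype.subsetP => i; rewrite inE => /set_mem iB; rewrite inE.
apply: le_lt_trans (norm2_sub_sq_le _ _ theta) _.
move: kB iB; rewrite /B /= !excess_lossE //.
have n1 : 0 < n%:R :> R by rewrite ltr0n.
set a := norm2 _ ^+ 2; set b := norm2 _ ^+ 2 => ka ib.
rewrite -(ltr_pM2l n1); lra.
Qed.

(** * Data sets of cube points and their minimizers *)

(** Boolean vectors index the cube points, so that the packing is counted in a finite type. *)
Definition cube_point (R : realType) (p : nat) (v : {ffun 'I_p -> bool}) :
    'rV[R]_p :=
  \row_j ((2 * (v j)%:R - 1) / Num.sqrt p%:R).

Lemma cube_point_in (R : realType) (p : nat) (v : {ffun 'I_p -> bool}) :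
  in_cube (cube_point R v).
Proof.
apply/forallP => j; rewrite !mxE.
by case: (v j); apply/orP; [right|left]; apply/eqP; rewrite -?mulNr;
  congr (_ / _); rewrite /=; lra.
Qed.

Definition cube_data (R : realType) (n p : nat)
    (f : 'I_n -> {ffun 'I_p -> bool}) : data_set R n p :=
  [tuple exist _ (cube_point R (f i)) (cube_point_in R (f i)) | i < n].

Lemma cube_data_diff (R : realType) (n p : nat)
    (f g : 'I_n -> {ffun 'I_p -> bool}) :
  [set i | tnth (cube_data R f) i != tnth (cube_data R g) i]%SET
    \subset [set i | f i != g i]%SET.
Proof.
apply/fintype.subsetP => i; rewrite !inE !tnth_mktuple; apply: contra => /eqP fg.
by apply/eqP/val_inj; rewrite /= fg.
Qed.

(** Coordinate [j] of a minimizer is [(2 c - n) / (n sqrt p)], with [c] the number of positive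
    entries there; the shift by [n] cancels in the difference. *)
Lemma theta_star_cube_data (R : realType) (n p : nat)
    (f g : 'I_n -> {ffun 'I_p -> bool}) : (0 < p)%N ->
  norm2 (theta_star (cube_data R f) - theta_star (cube_data R g)) ^+ 2 =
  4 / (n%:R ^+ 2 * p%:R) *
    \sum_j ((\sum_i f i j)%:R - (\sum_i g i j)%:R) ^+ 2.
Proof.
move=> p0; rewrite norm2_sq mulr_sumr; apply: eq_bigr => j _.
have starE (h : 'I_n -> {ffun 'I_p -> bool}) : theta_star (cube_data R h) 0 j =
    n%:R^-1 * ((2 * (\sum_i h i j)%:R - n%:R) / Num.sqrt p%:R).
  rewrite /theta_star mxE summxE; congr (_ * _).
  rewrite (eq_bigr (fun i => (2 * (h i j)%:R - 1) / Num.sqrt p%:R)).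
    by rewrite -mulr_suml sumrB -mulr_sumr sumr_const card_ord -natr_sum.
  by move=> i _; rewrite /cube_data tnth_mktuple mxE.
have sp : (Num.sqrt p%:R)^-1 ^+ 2 = p%:R^-1 :> R.
  by rewrite exprVn sqr_sqrtr ?ler0n.
rewrite row_subE !starE invfM -exprVn -sp.
by move: (n%:R^-1) ((Num.sqrt p%:R)^-1) => u w; ring.
Qed.

Lemma sum_ord_lt (m n : nat) : (m <= n)%N -> (\sum_(i < n) (i < m))%N = m.
Proof.
move=> mn; have -> : (\sum_(i < n) (i < m) = \sum_(i < n | i < m) 1)%N.
  by rewrite [RHS]big_mkcond; apply: eq_bigr => i _; case: (i < m)%N.
by rewrite (big_ord_narrow mn) sum1_card card_ord.
Qed.

Lemma card_ord_lt (m n : nat) :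
  (m <= n)%N -> #|[set i : 'I_n | (i < m)%N]%SET| = m.
Proof.
move=> mn; rewrite -[RHS](sum_ord_lt mn) -sum1dep_card big_mkcond.
by apply: eq_bigr => i _; case: (i < m)%N.
Qed.

(** * Hamming balls and the numerical packing inequality *)

Definition hamming (p : nat) (v w : {ffun 'I_p -> bool}) : nat :=
  #|[set j | v j != w j]%SET|.

(* Chernoff: each point of the ball contributes at least [z ^+ p] to
   [\sum_w z ^+ (k * hamming v w) = (1 + z ^+ k) ^+ p]. *)
Lemma hamming_ball_card (R : realType) (p k : nat) (z : R)
    (v : {ffun 'I_p -> bool}) : 0 <= z <= 1 ->
  #|[set w | (k * hamming v w < p)%N]%SET|%:R * z ^+ p <= (1 + z ^+ k) ^+ p.
Proof.
move=> /andP[z0 z1].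
have <- : \sum_w z ^+ (k * hamming v w) = (1 + z ^+ k) ^+ p.
  transitivity (\sum_(w : {ffun 'I_p -> bool})
                  \prod_j (if v j != w j then z ^+ k else 1)).
    apply: eq_bigr => w _; rewrite -big_mkcond /= prodr_const exprM.
    by congr (_ ^+ _); apply: eq_card => j; rewrite !inE.
  rewrite -(bigA_distr_bigA (fun j b => if v j != b then z ^+ k else 1)).
  rewrite -[in RHS](card_ord p) -prodr_const; apply: eq_bigr => j _.
  by rewrite big_bool; case: (v j); rewrite //= addrC.
rewrite mulr_natl -sumr_const big_mkcond; apply: ler_sum => w _ /=.
rewrite inE; case: ifPn => [kw|_]; last exact: exprn_ge0.
by rewrite ler_wiXn2l // ltnW.
Qed.

(** From [e^(-1/16) >= 15/16] follows [e^(1/2) <= (16/15)^8], which is below 42/25. *)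
Lemma expR_half_le (R : realType) : expR (1 / 2) <= 42 / 25 :> R.
Proof.
have -> : 1 / 2 = - (- (1 / 16) * 8%:R) :> R by lra.
rewrite expRN expRM_natr -exprVn.
have e : 15 / 16 <= expR (- (1 / 16)) :> R.
  by apply: le_trans (expR_ge1Dx _); lra.
have e0 : 0 < expR (- (1 / 16)) :> R by exact: expR_gt0.
have iv : (expR (- (1 / 16)))^-1 <= 16 / 15 :> R.
  by rewrite -[leRHS]invrK lef_pV2 ?posrE ?invr_gt0 //; lra.
apply: (@le_trans _ _ ((16 / 15) ^+ 8)); last by lra.
by apply: lerXn2r => //; rewrite nnegrE ?invr_ge0 ?(ltW e0) //; lra.
Qed.

Lemma expR_half_pow (R : realType) (p : nat) :
  expR (p%:R / 2) = expR (1 / 2) ^+ p :> R.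
Proof. by rewrite -expRM_natl mulrA mulr1. Qed.

(* For [p <= 32] the ball is a singleton and [N = 1]. For [p > 32],
   [hamming_ball_card] with [z = 9/10] gives [N = (23/20)^p], as
   [1 + z^32 <= z * 23/20], and [23/20 * e^(1/2) <= 483/250 < 2]. *)
Lemma hamming_packing (R : realType) (p : nat) : (1 < p)%N ->
  exists2 N : R,
    forall v : {ffun 'I_p -> bool},
      #|[set w | (32 * hamming v w < p)%N]%SET|%:R <= N &
    (2 * N - 1) * expR (p%:R / 2) <= 2 ^+ p - 1.
Proof.
move=> p1; have e0 : 0 <= expR (1 / 2) :> R by exact: expR_ge0.
have eh := expR_half_le R.
rewrite expR_half_pow; have [p32|p32] := leqP p 32.
  exists 1 => [v|].
    rewrite (_ : [set w | _]%SET = [set v]%SET) ?cards1 //.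
    apply/setP => w; rewrite !inE; apply/idP/eqP => [hp|->].
      have /eqP : hamming v w = 0%N by lia.
      rewrite cards_eq0 => /eqP/setP h0; apply/ffunP => j.
      by have := h0 j; rewrite !inE => /negbFE/eqP.
    rewrite /hamming (_ : [set j | _]%SET = finset.set0) ?cards0; first by lia.
    by apply/setP => j; rewrite !inE eqxx.
  rewrite mulr1 addrK mul1r.
  (* Induction from [p = 2], where [(42/25)^2 < 3]. *)
  elim: p p1 {p32} => // -[//|[_ _|p IHp _]].
    by rewrite !expr2; nra.
  have := IHp isT; rewrite !(exprS _ p.+2).
  have : 0 <= expR (1 / 2) ^+ p.+2 :> R by exact: exprn_ge0.
  move: (_ ^+ p.+2) (2 ^+ p.+2) => x y; nra.
exists ((23 / 20) ^+ p) => [v|].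
  have z0 : 0 < (9 / 10) ^+ p :> R by apply: exprn_gt0; lra.
  rewrite -(ler_pM2r z0) -exprMn.
  apply: le_trans (hamming_ball_card 32 v _) _; first by lra.
  apply: lerXn2r; rewrite ?nnegrE; first by apply: addr_ge0 => //; apply: exprn_ge0; lra.
    lra.
  lra.
have ab : (23 / 20 * expR (1 / 2)) ^+ p <= (483 / 250) ^+ p :> R.
  by apply: lerXn2r; rewrite ?nnegrE; nra.
have a1 : 1 <= (483 / 250) ^+ p :> R by apply: exprn_ege1; lra.
have b0 : 0 <= expR (1 / 2) ^+ p :> R by exact: exprn_ge0.
have e1 : 1 <= expR (1 / 2) ^+ p :> R.
  by apply: exprn_ege1; have := expR_ge1Dx (1 / 2 : R); lra.
(* Since [p > 32], it is enough that [(500/483)^32 >= 3]. *)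
have a2 : 3 * (483 / 250) ^+ p <= 2 ^+ p :> R.
  have -> : p = (32 + (p - 32))%N by lia.
  rewrite !exprD mulrA; apply: ler_pM; last by apply: lerXn2r; rewrite ?nnegrE; lra.
  - lra.
  - by apply: exprn_ge0; lra.
  - lra.
move: ab; rewrite exprMn; lra.
Qed.

(** * Size of the replaced block *)

Lemma truncn_ge_half (R : realType) (x : R) : 1 <= x ->
  [/\ (0 < Num.truncn x)%N, (Num.truncn x)%:R <= x & x <= 2 * (Num.truncn x)%:R].
Proof.
move=> x1; have x0 : 0 <= x by lra.
have /andP[tx xt] := truncn_itv x0.
have t0 : (0 < Num.truncn x)%N.
  by rewrite lt0n; apply/eqP => t0; move: xt; rewrite t0; lra.
have : 1 <= (Num.truncn x)%:R :> R by rewrite ler1n.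
split=> //; move: xt; rewrite -natr1; lra.
Qed.

(** The alternatives say which bound limits the block size [m], and the minimum is estimated by the
    matching argument. The factor 4 absorbs rounding and halving. *)
Lemma min_mul_le (R : realType) (n eps x m : R) : 0 < n -> 0 < eps -> 0 <= x ->
  0 <= m -> n <= 4 * m \/ x <= 4 * (m * eps) ->
  Num.min n (x ^+ 2 / (eps ^+ 2 * n)) * n <= 16 * m ^+ 2.
Proof.
move=> n0 eps0 x0 m0 h; have e2 : 0 < eps ^+ 2 by rewrite exprn_gt0.
set a := Num.min _ _.
have [a1 a2] : a <= n /\ a <= x ^+ 2 / (eps ^+ 2 * n).
  by rewrite /a !ge_min !lexx orbT.
case: h => h.
  by apply: (@le_trans _ _ (n * n)); [rewrite ler_pM2r|nra].
rewrite -(ler_pM2r e2); move: a2; rewrite ler_pdivlMr ?mulr_gt0 // => a2.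
have xs : x ^+ 2 <= (4 * (m * eps)) ^+ 2.
  by apply: lerXn2r => //; rewrite nnegrE; nra.
rewrite -mulrA [n * _]mulrC; apply: (le_trans a2); apply: (le_trans xs).
by rewrite !exprMn; lra.
Qed.

(** * Dimension one *)

(** For [k <= 1] the differing indices lie below [m]; for [k = 2] they lie in [[m, 2m)]. *)
Lemma card_threshold_diff (n m k : nat) : (2 * m <= n)%N -> (k < 3)%N ->
  (#|[set i : 'I_n | (i < k * m)%N != (i < m)%N]%SET| <= m)%N.
Proof.
move=> mn k3; have mn1 : (m <= n)%N by lia.
have [k2|k2] := ltnP k 2.
  rewrite -[leqRHS](card_ord_lt mn1); apply: subset_leq_card.
  by apply/fintype.subsetP => i; rewrite !inE; case: ltnP => //; nia.
have -> : k = 2 by lia.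
have mE : #|([set i : 'I_n | (i < 2 * m)%N] :\: [set i : 'I_n | (i < m)%N])%SET| = m.
  rewrite cardsD (finset.setIidPr _) ?card_ord_lt //; first by lia.
  by apply/fintype.subsetP => i; rewrite !inE; lia.
rewrite -[leqRHS]mE; apply: subset_leq_card.
by apply/fintype.subsetP => i; rewrite !inE; lia.
Qed.

Lemma lower_bound_line (R : realType) (n : nat) (eps t : R)
    (A : algorithm R n 1) :
  (1 < n)%N -> 0 < eps -> eps <= 1 / 2 ->
  t <= 1 / 1024 * Num.min n%:R (1 / (eps ^+ 2 * n%:R)) ->
  differentially_private eps A ->
  exists D : data_set R n 1,
    ((1 / 2)%:E <= A D [set theta | (t <= excess_loss D theta)%R])%E.
Proof.
move=> n1 eps0 eps1 tle dp; apply: contrapT => /forallNP nA.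
have n0 : (0 < n)%N by exact: ltnW.
have n4 : (n <= 4 * n./2)%N by lia.
have half2 : (2 * n./2 <= n)%N by lia.
have nR : 0 < n%:R :> R by rewrite ltr0n.
have x1 : 1 <= 1 / (2 * eps) by rewrite ler_pdivlMr ?mulr_gt0 //; lra.
have [q0 qx xq] := truncn_ge_half x1.
set q := Num.truncn _ in q0 qx xq.
(* Halving [n] leaves room for the threshold [2m]; [q] keeps [eps * m <= 1/2]. *)
pose m := minn (n./2) q.
have m0 : (0 < m)%N by rewrite leq_min q0 half_gt0 n1.
have mn : (2 * m <= n)%N.
  by apply: leq_trans half2; rewrite leq_mul2l geq_minl.
pose f (k : 'I_3) (i : 'I_n) : {ffun 'I_1 -> bool} :=
  [ffun _ => (i < k * m)%N].
pose D k := cube_data R (f k).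
have card_I : #|'I_3|%:R = 3 :> R by rewrite card_ord.
have em : eps * m%:R <= 1 / 2.
  have : m%:R <= q%:R :> R by rewrite ler_nat geq_minr.
  move: qx; rewrite ler_pdivlMr ?mulr_gt0 //; nra.
pose k1 : 'I_3 := inord 1.
have : #|'I_3|%:R - 1 < (2 * 1 - 1) * expR (eps * m%:R) :> R.
  (* Here [s] is the squared distance between minimizers of consecutive thresholds, so no two of the
     three are closer and [N = 1]. *)
  apply: (@private_family_card _ _ _ eps (4 * m%:R ^+ 2 / n%:R ^+ 2) t A _ D k1)
    => //; first exact: ltW.
  - have mR : 0 < m%:R :> R by rewrite ltr0n.
    have -> : n%:R * (4 * m%:R ^+ 2 / n%:R ^+ 2) = 4 * m%:R ^+ 2 / n%:R :> R.
      by field; lra.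
    rewrite ler_pdivlMr //.
    have : Num.min n%:R (1 ^+ 2 / (eps ^+ 2 * n%:R)) * n%:R <= 16 * m%:R ^+ 2.
      apply: min_mul_le; rewrite ?(ltW mR) // /m.
      have [h|h] := leqP n./2 q; [left|right].
        by rewrite -natrM ler_nat.
      move: xq; rewrite ler_pdivrMr ?mulr_gt0 //; lra.
    move: tle; rewrite expr1n; move: (Num.min _ _) => a ta.
    have := sqr_ge0 (m%:R : R); have : t * n%:R <= 1 / 1024 * a * n%:R.
      by rewrite ler_pM2r.
    lra.
  - move=> k; apply: leq_trans (subset_leq_card (cube_data_diff R _ _)) _.
    have k1E : k1 = 1%N :> nat by rewrite inordK.
    apply: leq_trans (card_threshold_diff mn (ltn_ord k)).
    apply: subset_leq_card; apply/fintype.subsetP => i; rewrite !inE.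
    by apply: contra => /eqP e; apply/eqP/ffunP => j; rewrite !ffunE k1E mul1n.
  - move=> k; apply: (@le_trans _ _ #|[set k]%SET|%:R); last by rewrite cards1.
    rewrite ler_nat; apply: subset_leq_card.
    apply/fintype.subsetP => l; rewrite !inE theta_star_cube_data // big_ord1.
    have sumf u : (\sum_i f u i ord0 = u * m)%N.
      rewrite -[RHS](@sum_ord_lt _ n); last exact: leq_trans (leq_mul (ltn_ord u : u <= 2)%N (leqnn m)) mn.
      by apply: eq_bigr => i _; rewrite ffunE.
    rewrite !sumf !natrM -mulrBl mulr1 exprMn; apply: contraTT => lk.
    have kl1 : 1 <= (k%:R - l%:R) ^+ 2 :> R.
      have : (k.+1 <= l)%N || (l.+1 <= k)%N by rewrite -neq_ltn eq_sym.
      by case/orP; rewrite -(ler_nat R) -natr1; nra.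
    rewrite -leNgt (_ : 4 / _ * _ =
      4 * m%:R ^+ 2 / n%:R ^+ 2 * (k%:R - l%:R) ^+ 2); last by ring.
    by rewrite ler_peMr // divr_ge0 ?mulr_ge0 ?exprn_ge0.
  by move=> k; rewrite ltNge; apply/negP => h; exact: (nA (D k)).
rewrite card_I; have := expR_half_le R.
have : expR (eps * m%:R) <= expR (1 / 2) by rewrite ler_expR.
lra.
Qed.

(** * Dimension at least two *)

Lemma lower_bound_cube (R : realType) (n p : nat) (eps t : R)
    (A : algorithm R n p) :
  (0 < n)%N -> (1 < p)%N -> 0 < eps -> eps <= p%:R / 2 ->
  t <= 1 / 1024 * Num.min n%:R (p%:R ^+ 2 / (eps ^+ 2 * n%:R)) ->
  differentially_private eps A ->
  exists D : data_set R n p,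
    ((1 / 2)%:E <= A D [set theta | (t <= excess_loss D theta)%R])%E.
Proof.
move=> n0 p1 eps0 eps1 tle dp; apply: contrapT => /forallNP nA.
have p0 : (0 < p)%N by exact: ltnW.
have nR : 0 < n%:R :> R by rewrite ltr0n.
have pR : 0 < p%:R :> R by rewrite ltr0n.
have x1 : 1 <= p%:R / (2 * eps) by rewrite ler_pdivlMr ?mulr_gt0 //; lra.
have [q0 qx xq] := truncn_ge_half x1.
set q := Num.truncn _ in q0 qx xq.
pose m := minn n q.
have m0 : (0 < m)%N by rewrite leq_min q0 n0.
have mn : (m <= n)%N by exact: geq_minl.
have mR : 0 < m%:R :> R by rewrite ltr0n.
pose f (v : {ffun 'I_p -> bool}) (i : 'I_n) : {ffun 'I_p -> bool} :=
  [ffun j => (i < m)%N && v j].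
pose D v := cube_data R (f v).
have em : eps * m%:R <= p%:R / 2.
  have : m%:R <= q%:R :> R by rewrite ler_nat geq_minr.
  move: qx; rewrite ler_pdivlMr ?mulr_gt0 //; nra.
have [N hN Ne] := hamming_packing R p1.
(* This makes [2 * N - 1] positive, so that [eps * m] can be replaced by [p / 2] at the end. *)
have N1 : 1 <= N.
  apply: le_trans (hN [ffun _ => false]); rewrite ler1n; apply/card_gt0P.
  exists [ffun _ => false]; rewrite inE /hamming.
  rewrite (_ : [set j | _]%SET = finset.set0) ?cards0 ?muln0 //.
  by apply/setP => j; rewrite !inE eqxx.
have : #|{ffun 'I_p -> bool}|%:R - 1 < (2 * N - 1) * expR (eps * m%:R) :> R.
  (* With this [s], squared distance [4 (m/n)^2 h / p] is below [s] exactly when [32 h < p]. The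
     condition [8 t <= n s] reads [t n <= m^2 / 64]; with the 16 of [min_mul_le] this gives the
     constant 1/1024. *)
  apply: (@private_family_card _ _ _ eps (m%:R ^+ 2 / (8 * n%:R ^+ 2)) t A _ D
            [ffun _ => false]) => //; first exact: ltW.
  - have -> : n%:R * (m%:R ^+ 2 / (8 * n%:R ^+ 2)) = m%:R ^+ 2 / (8 * n%:R) :> R.
      by field; lra.
    rewrite ler_pdivlMr ?mulr_gt0 //.
    have : Num.min n%:R (p%:R ^+ 2 / (eps ^+ 2 * n%:R)) * n%:R <= 16 * m%:R ^+ 2.
      apply: min_mul_le; rewrite ?ler0n // /m.
      have [h|h] := leqP n q; [left|right].
        have := ltW nR; lra.
      move: xq; rewrite ler_pdivrMr ?mulr_gt0 //; lra.
    move: tle; move: (Num.min _ _) => a ta.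
    have : t * n%:R <= 1 / 1024 * a * n%:R by rewrite ler_pM2r.
    lra.
  - move=> v; apply: leq_trans (subset_leq_card (cube_data_diff R _ _)) _.
    rewrite -[leqRHS](card_ord_lt mn); apply: subset_leq_card.
    apply/fintype.subsetP => i; rewrite !inE; apply: contraR => /negbTE im.
    by apply/eqP/ffunP => j; rewrite !ffunE im.
  - move=> v; apply: le_trans (hN v); rewrite ler_nat; apply: subset_leq_card.
    apply/fintype.subsetP => w; rewrite !inE theta_star_cube_data //.
    have sumf u j : (\sum_i f u i j)%N = (m * u j)%N.
      rewrite -[in RHS](sum_ord_lt mn) big_distrl /=; apply: eq_bigr => i _.
      by rewrite ffunE mulnb.
    rewrite (eq_bigr (fun j => if v j != w j then m%:R ^+ 2 else 0)); last first.
      move=> j _; rewrite !sumf; case: (v j) (w j) => [] [];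
        by rewrite /= ?muln1 ?muln0 ?subrr ?subr0 ?sub0r ?sqrrN ?expr0n.
    rewrite -big_mkcond sumr_const /=.
    rewrite (_ : #|_| = hamming v w); last by apply: eq_card => j; rewrite !inE.
    move: (hamming v w) => h.
    rewrite -(ltr_nat R) natrM -[_ *+ h]mulr_natr.
    have -> : 4 / (n%:R ^+ 2 * p%:R) * (m%:R ^+ 2 * h%:R) =
      m%:R ^+ 2 / (8 * n%:R ^+ 2) * (32 * h%:R / p%:R) :> R by field; lra.
    rewrite gtr_pMr ?divr_gt0 ?mulr_gt0 ?exprn_gt0 //.
    by rewrite ltr_pdivrMr // mul1r.
  by move=> k; rewrite ltNge; apply/negP => h; exact: (nA (D k)).
rewrite card_ffun card_bool card_ord natrX.
have : expR (eps * m%:R) <= expR (p%:R / 2) by rewrite ler_expR.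
nra.
Qed.

(** For [n = 1], randomized response over the [2^p] cube points is exact with probability above 1/2
    once [e^eps > 2^p - 1]. This explains the upper bound on [eps] and the exclusion of
    [n = p = 1]. *)
Theorem theorem5p4 (R : realType) :
  exists c : R, 0 < c /\
  forall (n p : nat) (eps : R),
    (0 < n)%N -> (0 < p)%N -> 0 < eps ->
    (1 < n * p)%N -> eps <= p%:R / 2 ->
  forall A : algorithm R n p,
    multiset_invariant A -> output_in_ball A -> differentially_private eps A ->
  exists D : data_set R n p,
    ((1 / 2)%:E <=
      A D [set theta | (c * Num.min n%:R (p%:R ^+ 2 / (eps ^+ 2 * n%:R))
                        <= excess_loss D theta)%R])%E.
Proof.
exists (1 / 1024); split; first by lra.
move=> n p eps n0 p0 eps0 np1 epsp A _ _ dp.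
have [p1|p1] := ltnP 1 p; first exact: (@lower_bound_cube _ _ _ eps).
have pE : p = 1%N by apply/eqP; rewrite eqn_leq p1.
subst p; rewrite muln1 in np1.
by apply: (@lower_bound_line _ _ eps) => //; rewrite expr1n.
Qed.
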